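(* Fix a finite field $\mathbb{F}_q$. For each prime number $n$ let $N_n$ denote the number of $D$-complicated functions $f:\{1,\ldots,n\}\to\mathbb{F}_q$. Then $\dfrac{N_n}{q^n}\to 1$ as $n\to\infty$ along the prime numbers.
   Context: Let $\mathbb{F}_q$ be a finite field with $q$ elements and let $n$ be a natural number. Let $M=\mathbb{F}_q^n$ be the set of all closed (cyclic) sequences $x=(x_1,\ldots,x_n)$ of $n$ elements of $\mathbb{F}_q$, with the convention $x_{n+1}=x_1$. The finite difference operator $\Delta:M\to M$ is defined by $(\Delta x)_i=x_{i+1}-x_i$, $i=1,\ldots,n$. A differential operator is any linear operator $D:M\to M$ representable in the form $D=\sum_{i=1}^m d_i\Delta^i$ with $m\ge 1$ and $d_i\in\mathbb{F}_q$ (no constant term). For a given $D$ and $x\in M$, the sequence $x,Dx,D^2x,\ldots$ is eventually periodic; its period is the length of the cycle it eventually enters, and its preperiod is the least $k\ge 0$ such that $D^kx$ lies on that cycle. A function $f:\{1,\ldots,n\}\to\mathbb{F}_q$ is identified with the sequence $x\in M$, $x_i=f(i)$. The function $f$ is called almost most complicated for $D$ if the period of $x,Dx,D^2x,\ldots$ is the maximum of the periods over all initial vectors in $M$, and the preperiod of $x,Dx,D^2x,\ldots$ differs by at most one from the maximum of the preperiods over all initial vectors in $M$. The function $f$ is called $D$-complicated if it is almost most complicated for every differential operator $D$. *)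

(* Defs.v *)
From HB Require Import structures.
From mathcomp Require Import all_boot all_order all_algebra.
From mathcomp Require Import all_classical reals topology normedtype.

Set Implicit Arguments.
Unset Strict Implicit.
Unset Printing Implicit Defensive.

Import Order.TTheory GRing.Theory Num.Theory.
Import numFieldNormedType.Exports.

Local Open Scope ring_scope.

Section Orbits.
Variables (T : finType) (g : T -> T).

Definition on_cycle (y : T) : bool := fconnect g (g y) y.

Lemma eventually_on_cycle (x : T) : exists k, on_cycle (iter k g x).
Proof.
have /loopingP/(_ (fingraph.order g x))/trajectP[i lti e] :=
  looping_order g x.
exists i; rewrite /on_cycle.
have {2}-> : iter i g x = iter (fingraph.order g x - i).-1 g (g (iter i g x)).
  by rewrite -iterSr prednK ?subn_gt0// -iterD subnK// ltnW.
exact: fconnect_iter.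
Qed.

Definition preperiod (x : T) : nat := ex_minn (eventually_on_cycle x).

(* [fingraph.order g y] is the number of points reachable from [y], which is
   the length of the cycle through [y] when [y] lies on a cycle. *)
Definition period (x : T) : nat := fingraph.order g (iter (preperiod x) g x).

End Orbits.

Section Complicated.
Variables (F : finFieldType) (n : nat).

(* [ordS] is the cyclic successor on ['I_n]; indices run from 0 to n - 1. *)
Definition finite_difference (x : 'rV[F]_n) : 'rV[F]_n :=
  \row_i (x 0 (ordS i) - x 0 i).

Definition differential_operator (D : {linear 'rV[F]_n -> 'rV[F]_n}) : Prop :=
  exists (m : nat) (d : nat -> F), (1 <= m)%N /\
    forall x, D x = \sum_(1 <= i < m.+1) d i *: iter i finite_difference x.

Definition almost_most_complicated (D : 'rV[F]_n -> 'rV[F]_n)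
    (f : {ffun 'I_n -> F}) : Prop :=
  let x : 'rV[F]_n := \row_i f i in
  period D x = \max_(y : 'rV[F]_n) period D y /\
  (`|(\max_(y : 'rV[F]_n) preperiod D y)%N%:Z - (preperiod D x)%:Z|%N <= 1)%N.

Definition D_complicated (f : {ffun 'I_n -> F}) : Prop :=
  forall D : {linear 'rV[F]_n -> 'rV[F]_n},
    differential_operator D -> almost_most_complicated D f.

Definition num_D_complicated : nat :=
  #|[set f : {ffun 'I_n -> F} | `[< D_complicated f >]]%SET|.

End Complicated.

(* Main.v *)
Require Import Defs.
From mathcomp Require Import all_boot all_order all_algebra cyclic finfield.
From mathcomp Require Import all_classical reals topology normedtype.

Import Order.TTheory GRing.Theory Num.Theory.
Import numFieldNormedType.Exports.

Local Open Scope classical_set_scope.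
Local Open Scope ring_scope.

(**
Identify a cyclic sequence x with the residue c = sum x_i X^(n-1-i) modulo
X^n - 1. The cyclic shift becomes multiplication by X, so a differential
operator D becomes multiplication by some A = (X - 1) B
([differential_operator_cyclic_poly]). Write q for the cardinal of F, suppose
that n is prime to q, and put Phi = 1 + X + ... + X^(n-1).

Preperiods are harmless. For N = q^totient(n) we have X^N = X modulo X^n - 1,
while the N-th power is a ring endomorphism of F[X] fixing the constants;
hence A^N = A modulo X^n - 1, that is, D^N = D. So D y always lies on a cycle
([differential_operator_on_cycle]), and every preperiod is 0 or 1.

Periods are maximal when c is coprime to Phi. If D^(k+1) x = D x, then
X^n - 1 = (X - 1) Phi divides (A^(k+1) - A) c; cancelling X - 1 and then c,
it divides A^(k+1) - A, so that D^(k+1) = D. Thus no sequence has a longer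
period than x ([D_complicated_coprimep]).

It remains to count the c which share a factor with Phi when n is a prime not
dividing q. If g is a nonconstant divisor of Phi of degree e, the powers
1, X, ..., X^(n-1) are distinct modulo g, whence n <= q^e
([leq_card_divisor]). So every nonconstant divisor of Phi has degree at least
d = up_log q n, the least exponent with n <= q^d. The polynomial Phi has at
most (n - 1) / d irreducible factors, each dividing at most q^(n-d) of the
polynomials of degree less than n ([card_not_coprimep_rV]). The proportion of
bad c is therefore at most n / (d q^d) <= 1 / d, which tends to 0.
*)

(** * Orbits of a self-map of a finite set *)

Lemma order_iter_on_cycle {T : finType} (g : T -> T) (z : T) (k : nat) :
  on_cycle g z -> fingraph.order g (iter k g z) = fingraph.order g z.
Proof.
rewrite /on_cycle fconnect_f => cyc.
apply: (eq_order_cycle cyc); first exact: in_orbit.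
by rewrite -fconnect_orbit fconnect_iter.
Qed.

Lemma preperiod_on_cycle {T : finType} (g : T -> T) (x : T) :
  on_cycle g (iter (preperiod g x) g x).
Proof. by rewrite /preperiod; case: ex_minnP. Qed.

Lemma preperiod_le {T : finType} (g : T -> T) (x : T) (k : nat) :
  on_cycle g (iter k g x) -> (preperiod g x <= k)%N.
Proof. by rewrite /preperiod; case: ex_minnP => m _ min_m /min_m. Qed.

Lemma period_iter {T : finType} (g : T -> T) (x : T) (k : nat) :
  (preperiod g x <= k)%N -> period g x = fingraph.order g (iter k g x).
Proof.
move=> le_k; rewrite /period -(subnK le_k) iterD.
by rewrite [RHS]order_iter_on_cycle // preperiod_on_cycle.
Qed.

Lemma on_cycleP {T : finType} (g : T -> T) (z : T) :
  on_cycle g z <-> exists k, iter k.+1 g z = z.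
Proof. exact: (orbitPcycle 2 3). Qed.

Lemma order_le_iter {T : finType} (g : T -> T) (z : T) (k : nat) :
  iter k.+1 g z = z -> (fingraph.order g z <= k.+1)%N.
Proof.
move=> gz; rewrite -(size_traject g z k.+1).
apply: order_le_cycle; last exact: mem_head.
by rewrite /=; apply/fpathP; exists k.+1; rewrite trajectSr -iterSr gz.
Qed.

(** Once every image is on a cycle, the period of [y] is the least [k > 0] with
    [iter k g (g y) = g y]; an identity of this kind that spreads from [x] to all
    [y] therefore makes the period of [x] an upper bound. *)
Lemma period_eq_max {T : finType} (g : T -> T) (x : T) :
    (forall y, on_cycle g (g y)) ->
    (forall k, iter k.+2 g x = g x -> forall y, iter k.+2 g y = g y) ->
  period g x = \max_(y : T) period g y.
Proof.
move=> cyc gx.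
have periodE y : period g y = fingraph.order g (g y).
  exact/(@period_iter _ _ _ 1)/preperiod_le/cyc.
apply/eqP; rewrite eqn_leq (leq_bigmax x) /=.
apply/bigmax_leqP => y _; rewrite !periodE -(orderSpred g (g x)).
apply: order_le_iter; rewrite -iterSr; apply: gx.
by rewrite iterSr orderSpred; apply/(orbitPcycle 2 4)/cyc.
Qed.

(** * Cyclic sequences as residues modulo X^n - 1 *)

(** The coefficients are reversed so that the shift to the successor index is
    multiplication by ['X] and not by its inverse. *)
Definition cyclic_poly {F : fieldType} {n : nat} (x : 'rV[F]_n) : {poly F} :=
  rVpoly (\row_i x 0 (rev_ord i)).

Lemma size_cyclic_poly {F : fieldType} {n : nat} (x : 'rV[F]_n) :
  (size (cyclic_poly x) <= n)%N.
Proof. exact: size_poly. Qed.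

Lemma cyclic_poly_inj {F : fieldType} {n : nat} :
  injective (@cyclic_poly F n).
Proof.
move=> x y /(can_inj rVpolyK) /rowP e; apply/rowP => i.
by have := e (rev_ord i); rewrite !mxE rev_ordK.
Qed.

Lemma cyclic_poly_lin {F : fieldType} {n : nat} (c : F) (x y : 'rV[F]_n) :
  cyclic_poly (c *: x + y) = c *: cyclic_poly x + cyclic_poly y.
Proof.
by rewrite /cyclic_poly -linearP; congr rVpoly; apply/rowP => i; rewrite !mxE.
Qed.

Lemma coef_cyclic_poly {F : fieldType} {n : nat} (x : 'rV[F]_n) (i : 'I_n) :
  (cyclic_poly x)`_(rev_ord i) = x 0 i.
Proof. by rewrite coef_rVpoly_ord mxE rev_ordK. Qed.

Lemma cyclic_poly_modp {F : fieldType} {n : nat} (x : 'rV[F]_n) :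
  cyclic_poly x %% ('X^n - 1) = cyclic_poly x.
Proof.
case: n x => [|n] x; first by rewrite subrr modp0.
by rewrite modp_small // size_XnsubC // ltnS size_cyclic_poly.
Qed.

(** Multiplication by ['X] pushes only the entry of index 0 out to degree [n],
    and reduction modulo ['X^n - 1] brings it back in degree 0. *)
Lemma cyclic_poly_shift {F : fieldType} {n : nat} (x : 'rV[F]_n) :
  cyclic_poly (\row_i x 0 (ordS i)) = ('X * cyclic_poly x) %% ('X^n - 1).
Proof.
case: n x => [|n] x.
  have z (y : 'rV[F]_0) : cyclic_poly y = 0.
    by apply/eqP; rewrite -size_poly_leq0 size_cyclic_poly.
  by rewrite !z mulr0 mod0p.
suff -> : 'X * cyclic_poly x =
    (x 0 ord0)%:P * ('X^(n.+1) - 1) + cyclic_poly (\row_i x 0 (ordS i)).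
  by rewrite modp_addl_mul_small // size_XnsubC // ltnS size_cyclic_poly.
apply/polyP => k; rewrite coefXM coefD coefCM coefB coefXn coef1.
have co (i : nat) (y : 'rV[F]_n.+1) :
    (cyclic_poly y)`_i = if (i <= n)%N then y 0 (inord (n - i)) else 0.
  case: ifP => [lein|nle].
    have {1}-> : i = rev_ord (inord (n - i) : 'I_n.+1).
      by rewrite /= inordK ?ltnS ?leq_subr // subSS subKn.
    exact: coef_cyclic_poly.
  by rewrite nth_default // (leq_trans (size_cyclic_poly _)) // ltnNge nle.
rewrite !co !mxE; case: k => [|k] /=.
  rewrite sub0r mulrN1 subn0 (_ : ordS _ = ord0) ?addNr //.
  by apply: val_inj; rewrite /= inordK // modnn.
rewrite subr0 eqSS; have [ltkn|ltnk|->] := ltngtP k n.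
- rewrite mulr0 add0r; congr (x 0 _); apply: val_inj.
  rewrite /= !inordK ?ltnS ?leq_subr // subnSK //.
  by rewrite modn_small // ltnS leq_subr.
- by rewrite mulr0 addr0.
rewrite mulr1 addr0 subnn; congr (x 0 _); apply: val_inj.
by rewrite /= inordK.
Qed.

Lemma cyclic_poly_finite_difference {F : finFieldType} {n : nat}
    (x : 'rV[F]_n) :
  cyclic_poly (finite_difference x) =
  (('X - 1) * cyclic_poly x) %% ('X^n - 1).
Proof.
have -> : finite_difference x = (-1) *: x + \row_i x 0 (ordS i).
  by apply/rowP => i; rewrite !mxE mulN1r addrC.
rewrite cyclic_poly_lin cyclic_poly_shift -[X in _ *: X]cyclic_poly_modp.
by rewrite -modpZl -modpD scaleN1r mulrBl mul1r addrC.
Qed.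

Lemma cyclic_poly_iter {F : fieldType} {n : nat} (g : 'rV[F]_n -> 'rV[F]_n)
    (A : {poly F}) :
    (forall x, cyclic_poly (g x) = (A * cyclic_poly x) %% ('X^n - 1)) ->
  forall k x, cyclic_poly (iter k g x) = (A ^+ k * cyclic_poly x) %% ('X^n - 1).
Proof.
move=> gA; elim=> [|k IHk] x; first by rewrite mul1r cyclic_poly_modp.
by rewrite iterS gA IHk modp_mul exprS mulrA.
Qed.

(** The absence of a constant term in [D] is what produces the factor ['X - 1];
    it is kept apart because it cancels against ['X^n - 1]. *)
Lemma differential_operator_cyclic_poly {F : finFieldType} {n : nat}
    (D : {linear 'rV[F]_n -> 'rV[F]_n}) :
    differential_operator D ->
  exists B : {poly F}, forall x,
    cyclic_poly (D x) = (('X - 1) * B * cyclic_poly x) %% ('X^n - 1).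
Proof.
case=> m [d [_ De]].
exists (\sum_(0 <= i < m) d i.+1 *: ('X - 1) ^+ i) => x.
rewrite De big_add1 /= mulr_sumr mulr_suml.
elim: (index_iota 0 m) => [|i s IHs].
  rewrite !big_nil mod0p.
  have := cyclic_poly_lin (-1) (0 : 'rV[F]_n) 0.
  by rewrite scaleN1r oppr0 addr0 scaleN1r addNr.
rewrite !big_cons cyclic_poly_lin modpD IHs -scalerAr -scalerAl modpZl.
by rewrite (cyclic_poly_iter _ _ cyclic_poly_finite_difference i.+1) exprS.
Qed.

(** * Dynamics of a differential operator *)

Lemma eqp_modp_dvdp {F : fieldType} (m p q : {poly F}) :
  p %% m = q %% m <-> m %| p - q.
Proof.
rewrite /dvdp modpD modpN subr_eq0; split=> [->|/eqP //].
exact: eqxx.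
Qed.

(** Raising to the power [N] is additive and fixes constants, so it acts on
    polynomials as the substitution of ['X^N] for ['X]; and ['X^N = 'X] modulo
    ['X^n - 1] because [N] is 1 modulo [n]. *)
Lemma dvdp_frobenius {F : fieldType} (n N : nat) (A : {poly F}) :
    [pchar F].-nat N -> (forall c : F, c ^+ N = c) -> (n %| N.-1)%N ->
  'X^n - 1 %| A ^+ N - A.
Proof.
move=> charN fixN /dvdnP[k Nk]; have N_gt0 : (0 < N)%N by case/andP: charN.
elim/poly_ind: A => [|A c IHA]; first by rewrite expr0n gtn_eqF // subr0 dvdp0.
rewrite exprDn_pchar; last by rewrite (eq_pnat _ (@pchar_poly F)).
rewrite exprMn -polyC_exp fixN opprD addrACA subrr addr0.
have -> : A ^+ N * 'X^N - A * 'X = (A ^+ N - A) * 'X^N + A * ('X^N - 'X).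
  by rewrite mulrBl mulrBr addrA subrK.
rewrite dvdp_add //; first exact: dvdp_mulr.
have -> : 'X^N - 'X = 'X * (('X^n) ^+ k - 1) :> {poly F}.
  by rewrite mulrBr mulr1 -exprM mulnC -Nk -exprS prednK.
by rewrite dvdp_mull // dvdp_mull // [X in _ %| X]subrX1 dvdp_mulr.
Qed.

Lemma card_pchar_nat (F : finFieldType) : [pchar F].-nat #|F|.
Proof.
have [p pr_p pF] := finPcharP F.
by rewrite (card_pprimeChar pF) pnatX pnatE // pF.
Qed.

Lemma expf_card_iter (F : finFieldType) (k : nat) (c : F) :
  c ^+ (#|F| ^ k) = c.
Proof.
by elim: k => [|k IHk]; rewrite ?expn0 ?expr1 // expnS exprM expf_card.
Qed.

(** Take [N = #|F| ^ totient n], which is 1 modulo [n] by Euler's theorem: the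
    Frobenius congruence then reads [iter N D y = D y]. *)
Lemma differential_operator_on_cycle {F : finFieldType} {n : nat}
    (D : {linear 'rV[F]_n -> 'rV[F]_n}) :
    (0 < n)%N -> coprime #|F| n -> differential_operator D ->
  forall y, on_cycle D (D y).
Proof.
move=> n_gt0 co_n /differential_operator_cyclic_poly[B DB] y.
pose N := (#|F| ^ totient n)%N.
have N_gt1 : (1 < N)%N.
  by rewrite -(exp1n (totient n)) ltn_exp2r ?totient_gt0 // finNzRing_gt1.
apply/on_cycleP; exists N.-2; rewrite -iterSr.
apply: cyclic_poly_inj; rewrite (cyclic_poly_iter _ _ DB) DB.
apply/eqp_modp_dvdp; rewrite -mulrBl dvdp_mulr //.
have -> : (N.-2.+2 = N)%N by case: N N_gt1 => [|[]].
apply: dvdp_frobenius.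
- by rewrite pnatX card_pchar_nat.
- exact: expf_card_iter.
have := Euler_exp_totient co_n; rewrite -/N => /eqP.
by rewrite eqn_mod_dvd ?subn1 // ltnW.
Qed.

(** Coprimality to [1 + 'X + ... + 'X^(n-1)], rather than to ['X^n - 1], is enough
    because the polynomial of [D] already vanishes modulo ['X - 1]. *)
Lemma D_complicated_coprimep {F : finFieldType} {n : nat}
    (f : {ffun 'I_n -> F}) :
    (0 < n)%N -> coprime #|F| n ->
    coprimep (\sum_(i < n) 'X^i) (cyclic_poly (\row_i f i)) ->
  D_complicated f.
Proof.
move=> n_gt0 co_n co_f D diffD; rewrite /almost_most_complicated.
have cyc := differential_operator_on_cycle D n_gt0 co_n diffD.
set x := \row_i f i in co_f *.
have pre_le1 y : (preperiod D y <= 1)%N by exact/preperiod_le/cyc.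
split; last first.
  have := pre_le1 x.
  have : (\max_(y : 'rV[F]_n) preperiod D y <= 1)%N by apply/bigmax_leqP.
  by case: (\max_(_ | _) _)%N => [|[]] //; case: (preperiod D x) => [|[]].
apply: period_eq_max => // k.
have [B DB] := differential_operator_cyclic_poly D diffD.
(* The factor 'X - 1 common to the modulus and to the polynomial of D cancels. *)
have dvdE y : iter k.+2 D y = D y <->
    \sum_(i < n) 'X^i %|
      (B * ((('X - 1) * B) ^+ k.+1 - 1)) * cyclic_poly y.
  have X1_neq0 : 'X - 1 != 0 :> {poly F} by exact: negbT (polyXsubC_eq0 1).
  rewrite -(dvdp_mul2l _ _ X1_neq0) -subrX1.
  have -> : ('X - 1) * (B * ((('X - 1) * B) ^+ k.+1 - 1) * cyclic_poly y) =
      (('X - 1) * B) ^+ k.+2 * cyclic_poly y - ('X - 1) * B * cyclic_poly y.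
    by rewrite !mulrA mulrBr mulr1 -exprS mulrBl.
  split=> [e|].
    apply/eqp_modp_dvdp; rewrite -DB -(cyclic_poly_iter _ _ DB).
    by congr cyclic_poly; exact: e.
  move/eqp_modp_dvdp; rewrite -DB -(cyclic_poly_iter _ _ DB).
  exact: cyclic_poly_inj.
by move/dvdE; rewrite Gauss_dvdpl // => dvdB y; apply/dvdE/dvdp_mulr.
Qed.

(** * Counting polynomials with a common factor *)

(** A nonconstant divisor of least size is irreducible. *)
Lemma irreducible_divisor {F : fieldType} (Q : {poly F}) :
  (1 < size Q)%N -> exists2 g : {poly F}, irreducible_poly g & g %| Q.
Proof.
move=> Q_gt1.
pose P k := `[< exists2 g : {poly F}, size g = k & (1 < k)%N && (g %| Q) >].
have exP : exists k, P k.
  by exists (size Q); apply/asboolP; exists Q; rewrite ?Q_gt1 /=.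
case: (ex_minnP exP) => k /asboolP[g sz_g /andP[k_gt1 gQ]] min_k.
exists g => //; split=> [|h h_neq1 hg]; first by rewrite sz_g.
have g_neq0 : g != 0 by rewrite -size_poly_gt0 sz_g ltnW.
rewrite -dvdp_size_eqp // eqn_leq dvdp_leq //= sz_g; apply: min_k.
apply/asboolP; exists h => //; rewrite (dvdp_trans hg) // andbT.
by rewrite ltn_neqAle eq_sym h_neq1 size_poly_gt0 (dvdpN0 hg).
Qed.

Lemma card_dvdp_rV {F : finFieldType} (n : nat) (g : {poly F}) : g != 0 ->
  (#|[set u : 'rV[F]_n | (g %| rVpoly u)%R]%SET| <= #|F| ^ (n - (size g).-1))%N.
Proof.
move=> g_neq0; set e := (n - _)%N.
have -> : (#|F| ^ e = #|{: 'rV[F]_e}|)%N by rewrite card_mx mul1n.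
apply: (@leq_card_in _ _ (fun u => poly_rV (rVpoly u %/ g))) => u v.
rewrite !inE => gu gv /(congr1 rVpoly).
have szq (w : 'rV[F]_n) : (size (rVpoly w %/ g)%R <= e)%N.
  by rewrite size_divp // leq_sub2r // size_poly.
rewrite !poly_rV_K // => euv; apply: (can_inj rVpolyK).
by rewrite -(divpK gu) -(divpK gv) euv.
Qed.

(** A union bound over the irreducible factors, organised as an induction that
    splits off one factor [g] at a time: [g] has degree at least [d], so the at
    most [#|F| ^ (n - d)] multiples of [g], counted [d] times, are paid for by the
    decrease of the degree. *)
Lemma card_not_coprimep_rV {F : finFieldType} (n d : nat) (Q : {poly F}) :
    Q != 0 ->
    (forall h : {poly F}, h %| Q -> (1 < size h)%N -> (d <= (size h).-1)%N) ->
  (d * #|[set u : 'rV[F]_n | ~~ coprimep Q (rVpoly u)]%SET|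
    <= (size Q).-1 * #|F| ^ (n - d))%N.
Proof.
have [k] := ubnP (size Q); elim: k Q => // k IHk Q.
rewrite ltnS => szQ Q_neq0 dQ.
have [Q_le1|Q_gt1] := leqP (size Q) 1.
  rewrite eq_card0 ?muln0 // => u; rewrite !inE; apply/negbTE; rewrite negbK.
  have /size_poly1P[c c_neq0 ->] : size Q == 1%N.
    by rewrite eqn_leq Q_le1 size_poly_gt0.
  by rewrite -[c%:P]mulr1 mul_polyC coprimepZl // coprime1p.
have [g irr_g gQ] := irreducible_divisor Q Q_gt1.
have [g_gt1 _] := irr_g; have g_neq0 := irredp_neq0 irr_g.
pose Q' := (Q %/ g)%R; have QE : Q = Q' * g by rewrite divpK.
have Q'_neq0 : Q' != 0 by apply: contraNneq Q_neq0 => Q'0; rewrite QE Q'0 mul0r.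
have szE : ((size Q).-1 = (size Q').-1 + (size g).-1)%N.
  rewrite QE size_mul //; move: g_gt1; have := Q'_neq0; rewrite -size_poly_gt0.
  by case: (size Q') => // a _; case: (size g) => // b _; rewrite !addSn addnS.
have szQ' : (size Q' < k)%N.
  apply: leq_trans szQ; rewrite -(prednK (ltnW Q_gt1)) szE ltnS.
  rewrite -[leqLHS]prednK ?size_poly_gt0 // -addn1 leq_add2l.
  by case: (size g) g_gt1 => [|[]].
have dg := dQ _ gQ g_gt1.
have dQ' (h : {poly F}) : h %| Q' -> (1 < size h)%N -> (d <= (size h).-1)%N.
  by move=> hQ'; apply: dQ; rewrite QE dvdp_mulr.
rewrite szE mulnDl.
apply: leq_trans (leq_add (IHk _ szQ' Q'_neq0 dQ') (leqnn _)).
have bad_g : (d * #|[set u : 'rV[F]_n | (g %| rVpoly u)%R]%SET|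
    <= (size g).-1 * #|F| ^ (n - d))%N.
  apply: leq_mul => //; apply: leq_trans (card_dvdp_rV _ _ g_neq0) _.
  by rewrite leq_exp2l ?finNzRing_gt1 // leq_sub2l.
apply: leq_trans (leq_add (leqnn _) bad_g).
rewrite -mulnDr leq_mul2l; apply/orP; right.
apply: leq_trans (leq_card_setU _ _).
apply/subset_leq_card/fintype.subsetP => u.
rewrite !inE {1}QE coprimepMl negb_and.
by rewrite (irreducible_poly_coprime _ irr_g) negbK.
Qed.

(** * Divisors of 1 + X + ... + X^(n-1) for prime n *)

Lemma size_sum_Xn {F : fieldType} (n : nat) :
  size (\sum_(i < n) 'X^i : {poly F}) = n.
Proof.
have -> : \sum_(i < n) 'X^i = \poly_(i < n) 1 :> {poly F}.
  by rewrite poly_def; apply: eq_bigr => i _; rewrite scale1r.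
by rewrite size_poly_eq ?oner_eq0.
Qed.

(** The Bezout relation [u * k = v * n + 1], transported to exponents of ['X]. *)
Lemma dvdp_Xn_sub1_coprime {F : fieldType} (g : {poly F}) (k n : nat) :
    coprime k n -> (0 < k)%N -> g %| 'X^k - 1 -> g %| 'X^n - 1 -> g %| 'X - 1.
Proof.
move=> co_kn k_gt0 gk gn.
have gX a m : g %| 'X^a - 1 -> g %| 'X^(a * m) - 1.
  by move=> ga; rewrite exprM subrX1 dvdp_mulr.
have [u v uv _] := egcdnP n k_gt0; rewrite (eqP co_kn) in uv.
have -> : 'X - 1 = ('X^(k * u) - 1) - ('X^(n * v) - 1) * 'X :> {poly F}.
  rewrite mulnC uv addn1 exprSr mulnC mulrBl mul1r opprB [RHS]addrC.
  by rewrite addrA subrK.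
by rewrite dvdp_sub ?dvdp_mulr ?gX.
Qed.

(** The [n] powers ['X^i], [i < n], have distinct residues modulo [g]: otherwise
    [g] divides some ['X^k - 1] with [0 < k < n], hence ['X - 1], but ['X - 1] is
    coprime to the sum since the latter takes the value [n] at 1. *)
Lemma leq_card_divisor {F : finFieldType} (n : nat) (g : {poly F}) :
    prime n -> (n%:R != 0 :> F) -> g %| \sum_(i < n) 'X^i -> (1 < size g)%N ->
  (n <= #|F| ^ (size g).-1)%N.
Proof.
move=> pr_n n_neq0 gPhi g_gt1; set e := (size g).-1.
have g_neq0 : g != 0 by rewrite -size_poly_gt0 ltnW.
have gXn : g %| 'X^n - 1 by rewrite subrX1 dvdp_mull.
have not_gX1 : ~~ (g %| 'X - 1).
  apply/negP => gX1.
  have : coprimep (\sum_(i < n) 'X^i) ('X - 1%:P : {poly F}).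
    rewrite coprimep_XsubC /root horner_sum (eq_bigr (fun=> 1)).
      by rewrite sumr_const card_ord.
    by move=> i _; rewrite hornerXn expr1n.
  move/coprimepP/(_ _ gPhi gX1); rewrite -size_poly_eq1.
  by rewrite gtn_eqF.
have cogX : coprimep g 'X.
  apply: coprimep_dvdr gXn _; rewrite coprimep_sym.
  have -> : 'X = 'X - 0%:P :> {poly F} by rewrite subr0.
  rewrite coprimep_sym coprimep_XsubC /root !hornerE oppr0 expr0n.
  by rewrite gtn_eqF ?prime_gt0 // sub0r oppr_eq0 oner_eq0.
have -> : (#|F| ^ e = #|{: 'rV[F]_e}|)%N by rewrite card_mx mul1n.
rewrite -[leqLHS]card_ord.
have inj_lt (i j : 'I_n) : (i < j)%N -> 'X^i %% g <> 'X^j %% g.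
  move=> ltij /esym/eqp_modp_dvdp.
  have -> : 'X^j - 'X^i = 'X^i * ('X^(j - i) - 1) :> {poly F}.
    by rewrite mulrBr mulr1 -exprD subnKC // ltnW.
  rewrite Gauss_dvdpr ?coprimep_expr // => gk.
  move/negP: not_gX1; apply; apply: dvdp_Xn_sub1_coprime gk gXn.
    rewrite coprime_sym prime_coprime // gtnNdvd ?subn_gt0 //.
    by rewrite (leq_ltn_trans (leq_subr _ _)).
  by rewrite subn_gt0.
apply: (@leq_card _ _ (fun i : 'I_n => poly_rV ('X^i %% g))) => i j.
have szm (p : {poly F}) : (size (p %% g)%R <= e)%N.
  by rewrite -ltnS prednK ?ltn_modp // ltnW.
move/(congr1 rVpoly); rewrite !poly_rV_K // => eij.
by apply: val_inj; have [/inj_lt|/inj_lt/nesym|] := ltngtP i j.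
Qed.

(** * The proportion of complicated functions *)

Lemma natr_prime_neq0 {F : finFieldType} (n : nat) :
  prime n -> coprime #|F| n -> n%:R != 0 :> F.
Proof.
move=> pr_n co_n; apply/negP => n0.
have nF : n \in [pchar F] by rewrite inE pr_n.
have := finNzRing_gt1 F; rewrite (card_pprimeChar nF) => cardF.
move: co_n; rewrite (card_pprimeChar nF) coprime_sym.
case: (logn _ _) cardF => [|k] // _.
by rewrite coprime_pexpr // /coprime gcdnn gtn_eqF ?prime_gt1.
Qed.

(** This is [1 - N_n / q^n <= 1 / up_log q n] without denominators. *)
Lemma card_not_D_complicated {F : finFieldType} (n : nat) :
    prime n -> coprime #|F| n ->
  (up_log #|F| n * (#|F| ^ n - num_D_complicated F n) <= #|F| ^ n)%N.
Proof.
move=> pr_n co_n; set d := up_log _ _.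
have F_gt1 : (1 < #|F|)%N := finNzRing_gt1 F.
pose Phi : {poly F} := \sum_(i < n) 'X^i.
have Phi_neq0 : Phi != 0.
  by rewrite -size_poly_gt0 size_sum_Xn prime_gt0.
have dPhi (h : {poly F}) : h %| Phi -> (1 < size h)%N -> (d <= (size h).-1)%N.
  move=> hPhi h_gt1; apply: up_log_min => //.
  exact: leq_card_divisor pr_n (natr_prime_neq0 n pr_n co_n) hPhi h_gt1.
have bad := card_not_coprimep_rV n d Phi Phi_neq0 dPhi.
rewrite size_sum_Xn in bad.
have d_le_n : (d <= n)%N by apply: up_log_min => //; rewrite ltnW // ltn_expl.
have -> : (#|F| ^ n = #|F| ^ d * #|F| ^ (n - d))%N by rewrite -expnD subnKC.
(* The factor n - 1 = deg Phi is absorbed by q^d. *)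
apply: leq_trans (leq_mul _ (leqnn _)); last first.
  exact: leq_trans (leq_pred n) (up_logP n F_gt1).
apply: leq_trans bad; rewrite leq_mul2l; apply/orP; right.
rewrite -expnD subnKC // -[n in (#|F| ^ n)%N]card_ord -card_ffun.
rewrite /num_D_complicated; set S := [set f | _]%SET.
rewrite -[S]finset.setCK -finset.cardsCs.
pose r (f : {ffun 'I_n -> F}) : 'rV[F]_n := \row_i f (rev_ord i).
have r_inj : injective r.
  move=> f g /rowP e; apply/ffunP => i.
  by have := e (rev_ord i); rewrite !mxE rev_ordK.
rewrite -(card_imset _ r_inj); apply/subset_leq_card/fintype.subsetP => u.
case/imsetP => f; rewrite !inE => /asboolPn not_f ->; apply/negP => co_f.
apply: not_f; apply: D_complicated_coprimep; rewrite ?prime_gt0 //.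
suff -> : cyclic_poly (\row_i f i) = rVpoly (r f) by [].
by congr rVpoly; apply/rowP => i; rewrite !mxE.
Qed.

(** * The limit along the primes *)

Theorem theorem1 (R : realType) (F : finFieldType) :
  (fun n : nat => (num_D_complicated F n)%:R / (#|F|%:R ^+ n) : R)
    @ within [set n : nat | prime n] \oo --> (1 : R).
Proof.
have F_gt1 : (1 < #|F|)%N := finNzRing_gt1 F.
apply/cvgrPdist_le => eps eps_gt0; rewrite near_withinE.
(* Beyond q^K the logarithm up_log q n is at least K, and K exceeds 1 / eps. *)
pose K := (Num.bound eps^-1).+1.
exists (#|F| ^ K).+1 => // n /= n_gt pr_n.
have n_gtF : (#|F| < n)%N.
  by apply: leq_ltn_trans n_gt; rewrite -{1}(expn1 #|F|) leq_exp2l.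
have co_n : coprime #|F| n.
  by rewrite coprime_sym prime_coprime // gtnNdvd // ltnW.
have := card_not_D_complicated n pr_n co_n.
have K_le : (K <= up_log #|F| n)%N.
  by rewrite -(up_expnK K F_gt1) leq_up_log // ltnW.
set N := num_D_complicated F n; set q := #|F| => bound.
have N_le : (N <= q ^ n)%N.
  by rewrite -[n in (q ^ n)%N]card_ord -card_ffun max_card.
have q_gt0 : (0 < (q ^ n)%:R :> R) by rewrite ltr0n expn_gt0 ltnW.
have -> : 1 - N%:R / q%:R ^+ n = (q ^ n - N)%:R / (q ^ n)%:R :> R.
  by rewrite natrB // mulrBl divff ?lt0r_neq0 // natrX.
rewrite ger0_norm ?divr_ge0 ?ler0n // ler_pdivrMr //.
have K_gt : eps^-1 <= K%:R.
  rewrite (le_trans (ltW (archi_boundP _))) ?invr_ge0 ?(ltW eps_gt0) //.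
  by rewrite ler_nat.
rewrite -ler_pdivrMl //; apply: le_trans (_ : K%:R * (q ^ n - N)%:R <= _).
  by rewrite ler_wpM2r.
rewrite -natrM ler_nat; apply: leq_trans bound.
by rewrite leq_mul2r K_le orbT.
Qed.
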